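(* Let $(\mathbf V,S^* )$ be a monotone sampling scheme and $f:\mathbf V\to[0,\infty)$. Let the L* estimator $\hat f^{(L)}$ be the solution of the integral equation $$\hat f^{(L)}(\rho,v)=\frac{\underline f^{(v)}(\rho)-\int_\rho^1\hat f^{(L)}(u,v)\,du}{\rho}\qquad\text{for all } v\in\mathbf V,\ \rho\in(0,1].$$ Then for all $v\in\mathbf V$ and $\rho\in(0,1]$, $$\hat f^{(L)}(\rho,v)=\frac{\underline f^{(v)}(\rho)}{\rho}-\int_\rho^1\frac{\underline f^{(v)}(u)}{u^2}\,du .$$ When $\underline f^{(v)}(1)=0$ (which can be assumed without loss of generality, since otherwise one can instead estimate the function $f(v)-\underline f^{(v)}(1)$, which satisfies this assumption, and then add the fixed value $\underline f^{(v)}(1)$ to the resulting estimate), the solution has the simpler form $$\hat f^{(L)}(\rho,v)=-\int_\rho^1\frac{\frac{d\underline f^{(v)}(u)}{du}}{u}\,du .$$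
   Context: A monotone sampling scheme consists of a set $\mathbf V$ (the data domain) and a map assigning to each seed $u\in(0,1]$ and data vector $v\in\mathbf V$ a set $S^*(u,v)\subseteq\mathbf V$ with $v\in S^*(u,v)$, such that for each fixed $v$ the set $S^*(u,v)$ is non-decreasing (under inclusion) in $u$. The outcome (sample) $S(u,v)$ of data $v$ with seed $u$ includes the seed $u$, and $S^*(u,v)$ is the set of all data vectors consistent with the outcome: $z\in S^*(u,v)$ implies $S(u,z)=S(u,v)$ and $S^*(u,z)=S^*(u,v)$. Standing assumption: if $z\in S^*(\rho,v)$ then there is $\epsilon>0$ such that $z\in S^*(x,v)$ for all $x\in(\rho-\epsilon,1]\cap(0,1]$. Lower bound function: $\underline f^{(v)}(u)=\inf\{f(z): z\in S^*(u,v)\}$ for $u\in(0,1]$; for fixed $v$ it is non-increasing and left-continuous in $u$, and, being monotone and bounded, it is differentiable almost everywhere. Estimators are assumed Lebesgue integrable in $u$.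
   Formalization: The simpler form with the derivative fails if the lower bound function jumps or has a singular part; it is proved when the lower bound function is absolutely continuous on [ρ,1], and in general with the derivative replaced by the Lebesgue–Stieltjes measure of the lower bound function. *)

(* Defs.v *)
From mathcomp Require Import all_boot all_order all_algebra.
From mathcomp Require Import all_classical all_reals all_analysis.

Set Implicit Arguments.
Unset Strict Implicit.
Unset Printing Implicit Defensive.

Import Order.TTheory GRing.Theory Num.Theory.
Import numFieldNormedType.Exports.

Local Open Scope classical_set_scope.
Local Open Scope ring_scope.

(* [consistent u v] is S^*(u, v).  It is a total function of u : R, but only
   its values at seeds u in (0, 1] are constrained or used.  The outcome of v
   with seed u is the pair (u, S^*(u, v)); [consistent_eq] says that all data
   in S^*(u, v) have that same outcome. *)
Record monotone_scheme (R : realType) (V : Type) := MonotoneScheme {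
  consistent :> R -> V -> set V ;
  consistent_refl : forall (u : R) (v : V), 0 < u <= 1 -> consistent u v v ;
  consistent_mono : forall (v : V) (u1 u2 : R), 0 < u1 -> u1 <= u2 -> u2 <= 1 ->
    consistent u1 v `<=` consistent u2 v ;
  consistent_eq : forall (u : R) (v z : V), 0 < u <= 1 -> consistent u v z ->
    consistent u z = consistent u v ;
  consistent_open : forall (rho : R) (v z : V), 0 < rho <= 1 -> consistent rho v z ->
    exists2 eps : R, 0 < eps &
      forall x : R, rho - eps < x -> 0 < x <= 1 -> consistent x v z }.

Definition lower_bound (R : realType) (V : Type) (S : monotone_scheme R V)
    (f : V -> R) (v : V) (u : R) : R :=
  inf (f @` S u v).

Definition is_Lstar (R : realType) (V : Type) (S : monotone_scheme R V)
    (f : V -> R) (fL : R -> V -> R) : Prop :=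
  (forall v : V, (@lebesgue_measure R).-integrable `]0, 1]
               (fun u => (fL u v)%:E)) /\
  (forall (v : V) (rho : R), 0 < rho <= 1 ->
     fL rho v = (lower_bound S f v rho
       - \int[@lebesgue_measure R]_(u in `[rho, 1]) fL u v) / rho).

(* nu is the Lebesgue-Stieltjes measure -dF on (0, 1), for a left-continuous
   non-increasing F: an atom of nu at a is the jump F(a) - F(a+). *)
Definition is_decrement_measure (R : realType) (F : R -> R)
    (nu : {measure set (measurableTypeR R) -> \bar R}) : Prop :=
  forall a b : R, 0 < a -> a <= b -> b <= 1 -> nu `[a, b[%classic = (F a - F b)%:E.

Definition absolutely_continuous_on (R : realType) (a b : R) (F : R -> R)
    : Prop :=
  forall e : R, 0 < e -> exists2 d : R, 0 < d &
    forall (n : nat) (x y : 'I_n -> R),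
      (forall i, [/\ a <= x i, x i <= y i & y i <= b]) ->
      trivIset [set: 'I_n] (fun i => `]x i, y i[%classic) ->
      \sum_(i < n) (y i - x i) < d ->
      \sum_(i < n) `|F (y i) - F (x i)| < e.

(* Main.v *)
(* Write F for the lower bound function of v and h for its L* estimator, so that
   F(u) = u h(u) + H(u) with H(u) the integral of h over [u, 1].  Fubini gives, for a
   measure m on a subset D of [rho, 1] and an m-integrable h,
     int_[rho,1] u^-2 (int_{t in D, u <= t} h(t) dm) du
       = int_D h(t) (1/rho - 1/t) dm.
   With m the Lebesgue measure this integrates H(u)/u^2, hence F(u)/u^2, and yields
   the first formula.  With h = 1 and m = -dF, for which m([u, 1)) = F(u) when
   F(1) = 0, the same identity turns the first formula into the second one.
   If F is absolutely continuous, -dF is dominated by the Lebesgue measure; by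
   Lebesgue's differentiation theorem its density is -F' almost everywhere. *)

Require Import Defs.
From HB Require Import structures.
From mathcomp Require Import all_boot all_order all_algebra.
From mathcomp Require Import all_classical all_reals all_analysis.
From mathcomp Require Import measurable_realfun ring lra.

Import Order.TTheory GRing.Theory Num.Theory.
Import numFieldNormedType.Exports.

Local Open Scope classical_set_scope.
Local Open Scope ring_scope.

(** * Calculus of the weight [u^-2] *)

Lemma continuous_inv_sqr (R : realType) (x : R) : x != 0 ->
  {for x, continuous (fun u : R => (u ^+ 2)^-1)}.
Proof.
move=> x0; apply: cvgV; first by rewrite expf_neq0.
exact: exprn_continuous.
Qed.

Lemma integral_inv_sqr (R : realType) (a b : R) : 0 < a -> a <= b ->
  (\int[@lebesgue_measure R]_(u in `[a, b]) ((u ^+ 2)^-1)%:E = (a^-1 - b^-1)%:E)%E.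
Proof.
move=> a0; rewrite le_eqVlt => /predU1P[<-|ab].
  by rewrite set_itv1 integral_set1 subrr.
have ne0 x : a <= x -> x != 0 by move=> ax; rewrite gt_eqF// (lt_le_trans a0).
have dV x : a <= x -> is_derive x 1 (fun y : R => - y^-1) (x ^+ 2)^-1.
  move=> /ne0 x0; have dx := derivableV x0 (@derivable_id _ _ x 1).
  split; first exact: derivableN.
  by rewrite deriveN// deriveV//= derive_id -[_ *: 1]/(_ * 1) mulr1 opprK.
have cV x : a <= x -> {for x, continuous (fun y : R => - y^-1)}.
  by move=> /dV dx; apply: differentiable_continuous; apply/derivable1_diffP.
rewrite (@continuous_FTC2 _ _ (fun y : R => - y^-1))//.
- by rewrite -EFinB opprK addrC.
- apply: continuous_in_subspaceT => x /[!inE]/= /[!in_itv]/= /andP[ax _].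
  exact/continuous_inv_sqr/ne0.
- split.
  + by move=> x /[!in_itv]/= /andP[/ltW ax _]; have [] := dV _ ax.
  + exact/cvg_at_right_filter/cV.
  + exact/cvg_at_left_filter/cV/ltW.
- move=> x /[!in_itv]/= /andP[/ltW ax _].
  by rewrite derive1E; have [] := dV _ ax.
Qed.

Lemma measurable_fun_inv_itv (R : realType) (a b : R) : 0 < a ->
  measurable_fun `[a, b] (fun u : measurableTypeR R => u^-1 : R).
Proof.
move=> a0; apply: subspace_continuous_measurable_fun => //.
apply: continuous_in_subspaceT => x /[!inE]/= /[!in_itv]/= /andP[ax _].
by apply: inv_continuous; rewrite gt_eqF// (lt_le_trans a0).
Qed.

(** * Exchange of integrals with the weight [u^-2] *)

Section fubini_inv_sqr.
Context {R : realType}.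
Notation leb := (@lebesgue_measure R).
Variables (m : {sigma_finite_measure set (measurableTypeR R) -> \bar R}).
Variables (rho : R) (D : set (measurableTypeR R)) (h : R -> R).
Hypotheses (rho_gt0 : 0 < rho) (mD : measurable D) (subD : D `<=` `[rho, 1]).
Hypothesis int_h : m.-integrable D (EFin \o h).

Let K : R -> R := (fun u => (u ^+ 2)^-1) \_ `[rho, 1].
Let H : R -> R := h \_ D.
Let E : set (measurableTypeR R * measurableTypeR R) := [set p | p.1 <= p.2].
(** Both domains of integration are built into the kernel through extension by zero, so that Fubini
    applies on the whole product space. *)
Let k (p : measurableTypeR R * measurableTypeR R) : \bar R :=
  (K p.1 * (H p.2 * \1_E p))%:E.

Let mE : measurable E.
Proof.
have := @measurable_fun_ler _ _ R setT _ _ (@measurable_fst _ _ (measurableTypeR R)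
  (measurableTypeR R)) (@measurable_snd _ _ (measurableTypeR R) (measurableTypeR R)).
by move=> /(_ measurableT [set true] I); rewrite setTI.
Qed.

Let mK : measurable_fun setT (K : measurableTypeR R -> R).
Proof.
apply/(measurable_restrictT _ _).1 => //.
apply: subspace_continuous_measurable_fun => //.
apply: continuous_in_subspaceT => x /[!inE]/= /[!in_itv]/= /andP[ax _].
by apply: continuous_inv_sqr; rewrite gt_eqF// (lt_le_trans rho_gt0).
Qed.

Let mH : measurable_fun setT (H : measurableTypeR R -> R).
Proof.
apply/(measurable_restrictT _ _).1 => //.
by apply/measurable_EFinP; exact: (measurable_int m).
Qed.

Let mk : measurable_fun setT k.
Proof.
apply/measurable_EFinP; apply: measurable_funM.
  exact: measurableT_comp.
apply: measurable_funM; first exact: measurableT_comp.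
exact: measurable_indic.
Qed.

Let indE u t : \1_E (u, t) = (u <= t)%R%:R :> R.
Proof. by rewrite indicE; congr (nat_of_bool _)%:R; apply/asboolP/idP. Qed.

Let integral_K t : D t ->
  (\int[leb]_u (K u * \1_E (u, t))%:E = (rho^-1 - t^-1)%:E)%E.
Proof.
move=> /subD/=; rewrite in_itv/= => /andP[rt t1].
rewrite -integral_inv_sqr// [RHS]integral_mkcond; apply: eq_integral => u _.
rewrite indE /K !patchE !mem_setE !in_itv/=.
have [ut|] := boolP (u <= t); last by rewrite mulr0 andbF.
by rewrite (le_trans ut t1) mulr1; case: ifPn.
Qed.

Let ge0_K u t : 0 <= K u * \1_E (u, t).
Proof.
by rewrite mulr_ge0// /K patchE; case: ifPn => // _; rewrite invr_ge0 sqr_ge0.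
Qed.

(** [g] is arbitrary because this serves twice: with [|h|] to prove the kernel integrable, and with
    [h] itself in the final identity. *)
Let integral_k1 (g : R -> R) (t : measurableTypeR R) :
  (\int[leb]_u (K u * ((g \_ D) t * \1_E (u, t)))%:E =
   ((fun t => (g t * (rho^-1 - t^-1))%:E) \_ D) t)%E.
Proof.
rewrite !patchE; case: ifPn => [/set_mem tD|tD]; last first.
  under eq_integral do rewrite mul0r mulr0.
  by rewrite integral0.
under eq_integral do rewrite mulrCA EFinM.
rewrite integralZl//; first by rewrite integral_K.
apply/integrableP; split.
  apply/measurable_EFinP/measurable_funM => //.
  by apply: (@measurableT_comp _ _ _ _ _ _ (\1_E : _ -> R)) => //; exact: measurable_indic.
under eq_integral do rewrite gee0_abs ?lee_fin//.
by rewrite integral_K// ltry.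
Qed.

Let inv_bounds t : D t -> 0 <= rho^-1 - t^-1 <= rho^-1.
Proof.
move=> /subD/=; rewrite in_itv/= => /andP[rt t1].
have t0 : 0 < t by rewrite (lt_le_trans rho_gt0).
by rewrite subr_ge0 lef_pV2 ?posrE// rt/= lerBlDr lerDl invr_ge0 ltW.
Qed.

Let mV : measurable_fun D (fun t => rho^-1 - t^-1).
Proof.
apply: (@measurable_funS _ _ _ _ `[rho, 1]%classic) => //.
by apply: measurable_funB => //; exact: measurable_fun_inv_itv.
Qed.

(** The factor lies between 0 and [rho^-1] on [D], so the product is dominated by [rho^-1 * h]. *)
Lemma integrable_mul_inv_sub : m.-integrable D (EFin \o (fun t => h t * (rho^-1 - t^-1))).
Proof.
apply: (@le_integrable _ _ _ m _ mD _ (fun t => (rho^-1 * h t)%:E)) => [|t tD|].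
- apply/measurable_EFinP/measurable_funM => //.
  by apply/measurable_EFinP; exact: (measurable_int m).
- have /andP[V0 Vr] := inv_bounds _ tD.
  rewrite lee_fin !normrM mulrC ler_pM//.
  by rewrite (ger0_norm V0) ger0_norm// invr_ge0 ltW.
- by under eq_fun do rewrite EFinM; exact: integrableZl.
Qed.

(** Tonelli: integrating the absolute kernel in [u] first leaves [|h t| * (rho^-1 - t^-1)], whose
    integral is finite by [integrable_mul_inv_sub]. *)
Let int_k : (leb \x m)%E.-integrable setT k.
Proof.
apply/integrable21ltyP => //.
under eq_integral.
  move=> t _; under eq_integral.
    move=> u _; rewrite abse_EFin mulrCA normrM [X in _ * X]ger0_norm; last exact: ge0_K.
    rewrite -mulrCA.
    rewrite (_ : `|H t| = ((fun t => `|h t|) \_ D) t); last first.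
      by rewrite /H !patchE; case: ifPn => //; rewrite normr0.
    over.
  rewrite integral_k1.
  over.
rewrite -integral_mkcond.
rewrite (eq_integral (fun t : measurableTypeR R => `|(h t * (rho^-1 - t^-1))%:E|%E)).
  by have /integrableP[] := integrable_mul_inv_sub.
move=> t /[!inE] /inv_bounds /andP[? _].
by rewrite /= normrM (ger0_norm (_ : 0 <= rho^-1 - t^-1)).
Qed.

Let section_k2 u : `[rho, 1]%classic u -> (\int[m]_t k (u, t) =
  ((\int[m]_(t in D `&` [set t | u <= t]) h t) / u ^+ 2)%:E)%E.
Proof.
move=> u01; rewrite /k.
have mDu : measurable (D `&` [set t | u <= t]).
  apply: measurableI => //.
  by have := @measurable_itv R `[u, +oo[; rewrite set_itv_c_infty.
have ihu : m.-integrable (D `&` [set t | u <= t]) (EFin \o h).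
  by apply: integrableS int_h => //; exact: subIsetl.
rewrite mulrC EFinM /Rintegral fineK; last exact: integrable_fin_num.
rewrite -(integralZl mDu ihu (u ^- 2)) [RHS]integral_mkcond; apply: eq_integral => t _.
rewrite indE /K /H !patchE (mem_set u01) /= in_setI.
have -> : (t \in [set t | u <= t]) = (u <= t) by apply/asboolP/idP.
by case: (t \in D); case: (u <= t)%R; rewrite /= ?mul0r ?mulr0 ?mulr1.
Qed.

Lemma integrable_tail_inv_sqr : leb.-integrable `[rho, 1]
  (EFin \o (fun u => (\int[m]_(t in D `&` [set t | u <= t]) h t) / u ^+ 2)).
Proof.
apply: (@eq_integrable _ _ _ _ _ _ (fun u => \int[m]_t k (u, t))%E) => //.
  by move=> u /[!inE] /section_k2.
apply: (@integrableS _ _ _ _ setT) => //.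
exact: integrable_fubini_F int_k.
Qed.

(** Both sides are iterated integrals of [k]: integrating in [t] first produces the tail of [h],
    integrating in [u] first produces the integral of [u^-2] over [rho, t]. *)
Lemma Rintegral_tail_inv_sqr :
  \int[leb]_(u in `[rho, 1])
    ((\int[m]_(t in D `&` [set t | u <= t]) h t) / u ^+ 2) =
  \int[m]_(t in D) (h t * (rho^-1 - t^-1)).
Proof.
congr fine; rewrite integral_mkcond.
transitivity (\int[leb]_u \int[m]_t k (u, t))%E.
  apply: eq_integral => u _; rewrite patchE; case: ifPn => [/set_mem /section_k2->//|u01].
  rewrite /k; under eq_integral do rewrite /K patchE (negbTE u01) mul0r.
  by rewrite integral0.
rewrite (Fubini int_k) [RHS]integral_mkcond; apply: eq_integral => t _.
exact: integral_k1.
Qed.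
End fubini_inv_sqr.

(** * The lower bound function *)

Section lower_bound_lemmas.
Context {R : realType} {V : Type} (S : monotone_scheme R V) (f : V -> R).
Hypothesis f_ge0 : forall v, 0 <= f v.

Let has_inf_lower_bound v u : 0 < u <= 1 -> has_inf (f @` S u v).
Proof.
move=> u01; split; first by exists (f v), v => //; exact: consistent_refl.
by exists 0 => _ [z _ <-].
Qed.

Lemma lower_bound_le_mem v z u : 0 < u <= 1 -> S u v z ->
  lower_bound S f v u <= f z.
Proof.
move=> u01 Suvz; apply: ge_inf; last by exists z.
by have [] := has_inf_lower_bound v u u01.
Qed.

Lemma lower_bound_le v u : 0 < u <= 1 -> lower_bound S f v u <= f v.
Proof. by move=> u01; apply: lower_bound_le_mem => //; exact: consistent_refl. Qed.

Lemma lower_bound_nincr v a b : 0 < a -> a <= b -> b <= 1 ->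
  lower_bound S f v b <= lower_bound S f v a.
Proof.
move=> a0 ab b1; have a01 : 0 < a <= 1 by rewrite a0 (le_trans ab).
have b01 : 0 < b <= 1 by rewrite (lt_le_trans a0 ab).
apply: lb_le_inf; first by have [] := has_inf_lower_bound v a a01.
move=> _ [z Sz <-]; apply: lower_bound_le_mem => //.
exact: consistent_mono Sz.
Qed.

(** A datum [z] nearly attaining the infimum at [rho] stays consistent a little to the left of [rho]
    by [consistent_open], so it bounds the infimum there as well. *)
Lemma lower_bound_left_continuous v rho e : 0 < rho <= 1 -> 0 < e ->
  exists2 d, 0 < d & forall x, rho - d < x -> 0 < x -> x <= rho ->
    lower_bound S f v x < lower_bound S f v rho + e.
Proof.
move=> rho01 e0; have [_ [z Sz <-] fz] := inf_adherent e0 (has_inf_lower_bound v rho rho01).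
have [d d0 dS] := consistent_open rho01 Sz.
exists d => // x dx x0 xrho; apply: le_lt_trans fz.
have x01 : 0 < x <= 1 by rewrite x0 (le_trans xrho)//; case/andP: rho01.
by apply: lower_bound_le_mem => //; exact: dS.
Qed.

(** All data in [S u v] share the consistent set of [v] at seed 1, so on [S u v] the subtracted term
    is a constant, and the infimum commutes with a shift. *)
Lemma lower_bound_sub1 v u : 0 < u <= 1 ->
  lower_bound S (fun z => f z - lower_bound S f z 1) v u =
  lower_bound S f v u - lower_bound S f v 1.
Proof.
move=> u01; rewrite /lower_bound.
have /andP[u0 u1] := u01.
have S1 z : S u v z -> S 1 z = S 1 v.
  move=> Suvz; have Suz := @consistent_mono _ _ S v u 1 u0 u1 (lexx 1) z Suvz.
  by apply: consistent_eq Suz; rewrite ltr01 lexx.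
have -> : (fun z => f z - inf (f @` S 1 z)) @` S u v =
    (fun r => r - inf (f @` S 1 v)) @` (f @` S u v).
  apply/seteqP; split=> [_ [z Sz <-]|_ [_ [z Sz <-] <-]].
    by exists (f z); [exists z|rewrite S1].
  by exists z => //; rewrite S1.
set c := inf (f @` S 1 v).
have [nE lE] := has_inf_lower_bound v u u01.
apply/eqP; rewrite eq_le; apply/andP; split.
  rewrite lerBrDr; apply: lb_le_inf => // r fr.
  rewrite -lerBrDr; apply: ge_inf; last by exists r.
  case: lE => m lm; exists (m - c) => _ [y fy <-].
  by apply: lerB => //; exact: lm.
apply: lb_le_inf; first by case: nE => r fr; exists (r - c), r.
by move=> _ [r fr <-]; apply: lerB => //; exact: ge_inf.
Qed.

Lemma lower_bound_sub1_ge0 z : 0 <= f z - lower_bound S f z 1.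
Proof. by rewrite subr_ge0 lower_bound_le// ltr01 lexx. Qed.

(** Adding a constant [c] to the estimate raises its integral over [rho, 1] by [c * (1 - rho)],
    while the lower bound rises by [c]; the difference [c * rho], divided by [rho], is [c] again. *)
Lemma Lstar_sub1 gL :
  is_Lstar S (fun z => f z - lower_bound S f z 1) gL ->
  is_Lstar S f (fun u v => gL u v + lower_bound S f v 1).
Proof.
move=> [igL gLE].
have icst v : (@lebesgue_measure R).-integrable `]0, 1]
    (EFin \o cst (lower_bound S f v 1)).
  apply: measurable_bounded_integrable => //.
    by rewrite /= lebesgue_measure_itv/= lte_fin ltr01 -EFinD ltry.
  exact: bounded_cst.
split=> [v|v rho rho01].
  have : (@lebesgue_measure R).-integrable `]0, 1] ((fun u => (gL u v)%:E) \+
      (EFin \o cst (lower_bound S f v 1)))%E by exact: integrableD.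
  by [].
have /andP[rho0 rho1] := rho01.
have sub : `[rho, 1]%classic `<=` `]0, 1]%classic.
  by apply: subset_itvr; rewrite bnd_simp.
rewrite RintegralD//=; last 2 first.
- by apply: integrableS (igL v).
- by apply: integrableS (icst v).
rewrite Rintegral_cst//= lebesgue_measure_itv/= lte_fin.
have -> : fine (if rho < 1 then (1%:E + (- rho)%:E)%E else 0%E) = 1 - rho.
  by rewrite lt_neqAle rho1 andbT; case: eqVneq => [->|]//=; rewrite subrr.
rewrite gLE// lower_bound_sub1//.
by field; rewrite gt_eqF.
Qed.

End lower_bound_lemmas.

(** * The measure [-dF] *)

(* Reflecting the axis turns F into a nondecreasing right-continuous function,
   made total by the constant F 1 to the left of -1 and by M to the right of 0. *)
Lemma exists_decrement_measure (R : realType) (F : R -> R) (M : R) :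
  (forall a b, 0 < a -> a <= b -> b <= 1 -> F b <= F a) ->
  (forall u, 0 < u <= 1 -> F u <= M) ->
  (forall rho e, 0 < rho <= 1 -> 0 < e -> exists2 d, 0 < d &
     forall x, rho - d < x -> 0 < x -> x <= rho -> F x < F rho + e) ->
  exists nu : {measure set (measurableTypeR R) -> \bar R},
    is_decrement_measure F nu.
Proof.
move=> Fnincr FM Flc.
pose G (x : R) : R := if 0 <= x then M else F (Num.min (- x) 1).
have min01 (x : R) : x < 0 -> 0 < Num.min (- x) 1 <= 1.
  by move=> x0; rewrite /Num.min; case: ifPn; lra.
(* [M] bounds [F] from above, which keeps [G] monotone across 0. *)
have Gnd : nondecreasing G.
  move=> x y xy; rewrite /G; case: (leP 0 y) => [y0|y0].
    by case: (leP 0 x) => // x0; exact/FM/min01.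
  have x0 := le_lt_trans xy y0; rewrite (lt_geF x0).
  have /andP[my0 my1] := min01 _ y0; have /andP[mx0 mx1] := min01 _ x0.
  by apply: Fnincr => //; rewrite le_min !ge_min lerN2 xy lexx orbT.
(* For [x < 0], moving right from [x] moves the argument of [F] to the left or leaves it at 1, so
   left-continuity of [F] is what applies. *)
have Grc (x : R) : G @ at_right x --> G x.
  apply/cvgrPdist_lt => e e0; have [x0|x0] := leP 0 x.
    near=> y; have xy : x < y by near: y; exact: nbhs_right_gt.
    by rewrite /G x0 (le_trans x0 (ltW xy)) subrr normr0.
  have [d d0 dF] := Flc _ _ (min01 _ x0) e0.
  near=> y; have xy : x < y by near: y; exact: nbhs_right_gt.
  have y0 : y < 0 by near: y; exact: nbhs_right_lt.
  have yxd : y < x + d by near: y; apply: nbhs_right_lt; rewrite ltrDl.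
  rewrite distrC ger0_norm ?subr_ge0; last exact/Gnd/ltW.
  rewrite ltrBlDl /G (lt_geF x0) (lt_geF y0); apply: dF.
  - by rewrite /Num.min; do 2 case: ifPn; lra.
  - by case/andP: (min01 _ y0).
  - by rewrite le_min !ge_min lerN2 (ltW xy) lexx orbT.
pose Gc : cumulative R R := HB.pack G (isCumulative.Build R _ R G Gnd Grc).
have mN : measurable_fun setT (-%R : measurableTypeR R -> measurableTypeR R).
  exact: oppr_measurable.
pose nu : {measure set (measurableTypeR R) -> \bar R} :=
  pushforward (lebesgue_stieltjes_measure Gc) (-%R : measurableTypeR R -> measurableTypeR R).
exists (nu mN) => a b a0 ab b1.
rewrite /nu /= /pushforward.
(* Reflection sends [a, b[ to ]-b, -a], the left-open type of interval on which the Stieltjes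
   measure is the increment of [G]. *)
have -> : -%R @^-1` `[a, b[%classic = `]- b, - a]%classic :> set R.
  by apply/seteqP; split=> x /=; rewrite !in_itv/= lerNr ltrNl andbC.
rewrite /lebesgue_stieltjes_measure /measure_extension measurable_mu_extE/=; last exact: is_ocitv.
rewrite wlength_itv_bnd ?lerN2//.
have b0 := lt_le_trans a0 ab.
rewrite /G !oppr_ge0 (lt_geF a0) (lt_geF b0) !opprK !min_l//.
exact: le_trans ab b1.
Unshelve. all: by end_near. Qed.

(** * Null sets and absolute continuity *)

(* No measurability is assumed of f and g: the integral is a supremum over simple
   functions, which may be cut off on N.  This is what allows one to integrate a
   derivative that takes junk values where it does not exist. *)
Section integral_off_null_set.
Context d (T : measurableType d) (R : realType).
Variables (mu : {measure set T -> \bar R}) (N : set T).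
Hypotheses (mN : measurable N) (muN : mu N = 0%E).
Import HBNNSimple.

Let nnintegral (f : T -> \bar R) := ereal_sup [set sintegral mu h | h in
  [set h : {nnsfun T >-> R} | forall x, ((h x)%:E <= f x)%E]].

Let nnintegral_le_off_null_set (f g : T -> \bar R) :
  (forall x, 0 <= g x)%E -> (forall x, ~ N x -> f x = g x) ->
  (nnintegral f <= nnintegral g)%E.
Proof.
move=> g0 fg; apply: ge_ereal_sup => _ [h hf <-].
have mNC : measurable (~` N) by exact: measurableC.
(* [h'] vanishes on [N], where nothing but [0 <= g] is known. *)
pose h' : {nnsfun T >-> R} := (h \* mindic R mNC)%R.
have -> : sintegral mu h = sintegral mu h'.
  rewrite -!integralT_nnsfun; apply: ae_eq_integral => //.
  - exact/measurable_EFinP.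
  - exact/measurable_EFinP.
  exists N; split => // x /= /not_implyP[_ hh'].
  apply: contrapT => Nx; apply: hh'.
  by rewrite mindicE mem_set// mulr1.
apply: ereal_sup_ubound; exists h' => // x.
rewrite /= mindicE; have [Nx|Nx] := pselect (N x).
  by rewrite memNset// mulr0.
by rewrite mem_set// mulr1 -fg.
Qed.

Lemma eq_integral_off_null_set (D : set T) (f g : T -> \bar R) :
  (forall x, D x -> ~ N x -> f x = g x) ->
  (\int[mu]_(x in D) f x = \int[mu]_(x in D) g x)%E.
Proof.
move=> fg; have fgD x : ~ N x -> (f \_ D) x = (g \_ D) x.
  by move=> Nx; rewrite !patchE; case: ifPn => // /set_mem Dx; exact: fg.
rewrite /integral; congr (_ - _)%E; apply/eqP; rewrite eq_le; apply/andP; split;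
  apply: nnintegral_le_off_null_set => //.
all: by move=> x Nx; rewrite ?funeposE ?funenegE fgD.
Qed.

End integral_off_null_set.

(* The intersection is half-open on the right so that a possible atom at the left
   endpoint a is covered as well. *)
Lemma open_interval_cap_itv (R : realType) (I : set R) (a b : R) : a <= b ->
  open I -> is_interval I -> exists xy : R * R,
    [/\ a <= xy.1, xy.1 <= xy.2 & xy.2 <= b] /\
    `]xy.1, xy.2[%classic `<=` I /\ I `&` `[a, b[%classic `<=` `[xy.1, xy.2[%classic.
Proof.
move=> ab oI itvI; pose J := I `&` `[a, b]%classic.
have [J0|/set0P J0] := eqVneq J set0.
  exists (a, a) => /=; split; first by rewrite lexx.
  rewrite set_itvoo0; split => // z [Iz]; rewrite /= in_itv/= => /andP[az zb].
  suff: J z by rewrite J0.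
  by split => //; rewrite /= in_itv/= az ltW.
have lJ : lbound J a by move=> z [_]; rewrite /= in_itv/= => /andP[].
have uJ : ubound J b by move=> z [_]; rewrite /= in_itv/= => /andP[].
have hlJ : has_lbound J by exists a.
have huJ : has_ubound J by exists b.
exists (inf J, sup J) => /=; split; last split.
- split; [exact: lb_le_inf| |exact: ge_sup].
  by have [z Jz] := J0; exact: le_trans (ge_inf hlJ Jz) (ub_le_sup huJ Jz).
- move=> z; rewrite /= in_itv/= => /andP[/(inf_lt J0)[p [Ip _] pz]].
  move=> /(sup_gt J0)[q [Iq _] zq].
  by apply: (itvI _ _ Ip Iq); rewrite (ltW pz) (ltW zq).
- move=> z [Iz]; rewrite /= !in_itv/= => /andP[az zb].
  have Jz : J z by split => //; rewrite /= in_itv/= az ltW.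
  apply/andP; split; first exact: ge_inf.
  (* Openness of [I] supplies a point of [I] to the right of [z], which puts [z] strictly below the
     supremum. *)
  have [w [Iw zw wb]] : exists w, [/\ I w, z < w & w < b].
    have nI : \forall w \near z^'+, I w by apply: cvg_within; apply: open_nbhs_nbhs.
    near (z^'+) => w; exists w; split; near: w => //.
    - exact: nbhs_right_gt.
    - exact: nbhs_right_lt.
  apply: (lt_le_trans zw); apply: (ub_le_sup huJ); split => //.
  by rewrite /= in_itv/= (le_trans az (ltW zw)) (ltW wb).
Unshelve. all: by end_near. Qed.

(** Outer regularity encloses the null set in an open set of measure below [d]. Its disjoint open
    components, clipped to [a, b], have total length below [d], so absolute continuity makes the sum
    of the decrements of [F] over them at most [e]. *)
Lemma absolutely_continuous_null (R : realType) (F : R -> R) (a b : R)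
    (nu : {measure set (measurableTypeR R) -> \bar R}) : a <= b ->
  (forall x y, a <= x -> x <= y -> y <= b -> nu `[x, y[%classic = (F x - F y)%:E) ->
  absolutely_continuous_on a b F ->
  forall A : set (measurableTypeR R), measurable A ->
    lebesgue_measure A = 0%E -> nu (A `&` `[a, b[%classic) = 0%E.
Proof.
move=> ab nuE acF A mA A0; apply/eqP; rewrite eq_le measure_ge0 andbT.
apply/lee_addgt0Pr => e /acF[d d0 dF]; rewrite add0e.
have [|U [oU AU UA]] := @lebesgue_regularity_outer R A d mA _ d0.
  by rewrite [X in (X < _)%E]A0 ltry.
have mU : measurable (U : set (measurableTypeR R)) by exact: open_measurable.
have muU : (lebesgue_measure U < d%:E)%E.
  rewrite (le_lt_trans _ UA)// -[U in leLHS](setDUK AU).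
  rewrite (le_trans (measureU2 _ _ _))//; first exact: measurableD.
  by rewrite [X in (X + _)%E]A0 add0e.
have /choice[xy xyP] k := open_interval_cap_itv _ _ _ _ ab (@open_disjoint_itv_open R U oU k)
  (@open_disjoint_itv_is_interval R U oU k).
pose x k := (xy k).1; pose y k := (xy k).2.
have tI n : trivIset [set: 'I_n] (fun k => `]x k, y k[%classic).
  move=> i j _ _ [z [zi zj]]; apply/val_inj.
  apply: (@open_disjoint_itv_trivIset R U oU) => //; exists z.
  by split; [apply: (xyP i).2.1|apply: (xyP j).2.1].
apply: (@le_trans _ _ (\sum_(0 <= k <oo) nu `[x k, y k[%classic)%E).
  apply: measure_sigma_subadditive => //.
    exact: measurableI.
  move=> z [Az abz]; have := AU z Az.
  rewrite (open_disjoint_itv_bigcup oU) => -[k _ Ikz].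
  by exists k => //; apply: (xyP k).2.2.
(* Absolute continuity speaks of finitely many intervals, so the series is bounded through its
   partial sums. *)
apply: lime_le; first exact: is_cvg_nneseries.
apply: nearW => n; rewrite big_mkord.
under eq_bigr => k _.
  have [[axk xyk ykb] _] := xyP k.
  rewrite nuE//; over.
rewrite sumEFin lee_fin ltW// (le_lt_trans _ (dF n x y _ (tI n) _))//.
- by apply: ler_sum => k _; rewrite distrC ler_norm.
- by move=> k; have [] := xyP k.
- rewrite -lte_fin; apply: le_lt_trans muU.
  have -> : ((\sum_(k < n) (y k - x k))%:E =
      \sum_(k < n) lebesgue_measure (`]x k, y k[%classic : set R))%E.
    rewrite -sumEFin; apply: eq_bigr => k _.
    rewrite lebesgue_measure_itv/= lte_fin EFinB.
    have [[_ xyk _] _] := xyP k.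
    move: xyk; rewrite le_eqVlt -/(x k) -/(y k) => /predU1P[->|->//].
    by rewrite ltxx -EFinB subrr.
  rewrite -measure_bigsetU_ord//; apply: le_measure; rewrite ?inE//.
    exact: bigsetU_measurable.
  rewrite -(bigcup_mkord n (fun k => `]x k, y k[%classic)) => z [k _ kz].
  by rewrite (open_disjoint_itv_bigcup oU); exists k => //; apply: (xyP k).2.1.
Qed.

(** * The estimator as a Lebesgue integral and as an integral against [-dF] *)

Lemma Lstar_eq (R : realType) (V : Type) (S : monotone_scheme R V)
    (f : V -> R) (fL : R -> V -> R) (v : V) (rho : R) :
  is_Lstar S f fL -> 0 < rho <= 1 ->
  fL rho v = lower_bound S f v rho / rho
    - \int[@lebesgue_measure R]_(u in `[rho, 1]) (lower_bound S f v u / u ^+ 2).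
Proof.
move=> [ifL fLE] /[dup] rho01 /andP[rho0 rho1].
pose h u := fL u v.
have ih : (@lebesgue_measure R).-integrable `[rho, 1] (EFin \o h).
  by apply: integrableS (ifL v) => //; apply: subset_itvr; rewrite bnd_simp.
have mI : measurable (`[rho, 1]%classic : set (measurableTypeR R)) by [].
pose H u := \int[@lebesgue_measure R]_(t in `[rho, 1] `&` [set t | u <= t]) h t.
have iH := integrable_tail_inv_sqr _ rho (`[rho, 1]%classic) h rho0 mI (@subset_refl _ _) ih.
have ihV := integrable_mul_inv_sub _ rho (`[rho, 1]%classic) h rho0 mI (@subset_refl _ _) ih.
have tailE := Rintegral_tail_inv_sqr _ rho (`[rho, 1]%classic) h rho0 mI (@subset_refl _ _) ih.
have ihr : (@lebesgue_measure R).-integrable `[rho, 1] (EFin \o (fun u => rho^-1 * h u)).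
  exact: (integrableZl mI rho^-1 ih).
(* The term [h u / u] is split as [rho^-1 * h u - h u * (rho^-1 - u^-1)] so that, after integration,
   its second half cancels the Fubini value of the integral of [H u / u ^+ 2]. Only [rho^-1] times
   the integral of [h] remains, and the defining equation at [rho] concludes. *)
have FE u : `[rho, 1]%classic u -> lower_bound S f v u / u ^+ 2 =
    (rho^-1 * h u - h u * (rho^-1 - u^-1)) + H u / u ^+ 2.
  rewrite /= in_itv/= => /andP[ru u1].
  have u0 : 0 < u by exact: lt_le_trans ru.
  have -> : H u = \int[@lebesgue_measure R]_(t in `[u, 1]) h t.
    congr (Rintegral _ _ _); apply/seteqP; split => t /=; rewrite !in_itv/=.
      by move=> [/andP[_ ->] ->].
    by move=> /andP[ut ->]; rewrite ut (le_trans ru).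
  have := fLE v u; rewrite u0 u1 -/(h u) => /(_ isT).
  move=> hE; rewrite {1 2}hE.
  by field; rewrite !gt_eqF.
rewrite (eq_Rintegral _ (g := fun u : measurableTypeR R =>
    (rho^-1 * h u - h u * (rho^-1 - u^-1)) + H u / u ^+ 2)); last first.
  by move=> u /[!inE] /FE.
rewrite RintegralD//=; last first.
  by apply: (@eq_integrable _ _ _ _ _ _ _ _ _ (integrableB mI ihr ihV)) => //.
rewrite RintegralB// tailE RintegralZl// subrK.
by rewrite fLE// mulrBl [rho^-1 * _]mulrC.
Qed.

Lemma Rintegral_decrement_inv (R : realType) (F : R -> R) (rho : R)
    (nu : {measure set (measurableTypeR R) -> \bar R}) :
  is_decrement_measure F nu -> F 1 = 0 -> 0 < rho <= 1 ->
  \int[nu]_(u in `[rho, 1[) u^-1 =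
  F rho / rho - \int[@lebesgue_measure R]_(u in `[rho, 1]) (F u / u ^+ 2).
Proof.
move=> nuF F1 /andP[rho0 rho1].
pose D : set (measurableTypeR R) := `[rho, 1[%classic.
have mD : measurable D by exact: measurable_itv.
have nuE u : rho <= u -> u <= 1 -> nu `[u, 1[%classic = (F u)%:E.
  by move=> ru u1; rewrite nuF ?(lt_le_trans rho0)// F1 subr0.
have nuD : (nu D < +oo)%E by rewrite nuE// ltry.
(* Restricting [nu] to [rho, 1[ gives a finite measure, of mass [F rho], to which the Fubini
   identity applies with [h = 1]. The interval excludes 1 because the decrements on (0, 1] do not
   determine the mass of [nu] at 1. *)
pose m : {finite_measure set (measurableTypeR R) -> \bar R} := mfrestr mD nuD.
have subD : D `<=` `[rho, 1].
  by apply: subset_itvl; rewrite bnd_simp.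
have icst (c : R) : m.-integrable D (EFin \o cst c).
  exact: finite_measure_integrable_cst.
have tailE := Rintegral_tail_inv_sqr m rho D (cst 1) rho0 mD subD (icst 1).
have ihV := integrable_mul_inv_sub m rho D (cst 1) rho0 mD subD (icst 1).
have iV : m.-integrable D (EFin \o (fun u => u^-1)).
  apply: eq_integrable (integrableB mD (icst rho^-1) ihV) => // u _.
  by rewrite /= mul1r -EFinB opprB addrC subrK.
rewrite [X in _ - X](eq_Rintegral _ (g := fun u : measurableTypeR R =>
    (\int[m]_(t in D `&` [set t | u <= t]) (cst 1 t)) / u ^+ 2)); last first.
  move=> u /[!inE]/= /[!in_itv]/= /andP[ru u1].
  rewrite Rintegral_cst ?mul1r//; last first.
    apply: measurableI => //.
    by have := @measurable_itv R `[u, +oo[; rewrite set_itv_c_infty.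
  rewrite /m /= /mfrestr /mrestr.
  have -> : D `&` [set t | u <= t] `&` D = `[u, 1[%classic.
    apply/seteqP; split => t; rewrite /D/= !in_itv/=.
      by move=> [[/andP[_ ->] ->] _].
    by move=> /andP[ut ->]; rewrite ut (le_trans ru).
  by rewrite nuE.
rewrite tailE /cst.
under [\int[m]_(_ in _) _]eq_Rintegral do rewrite mul1r.
rewrite RintegralB//; last exact: (icst rho^-1).
rewrite Rintegral_cst//.
have mDE : m D = (F rho)%:E by rewrite /m/= /mfrestr/= /mrestr setIid nuE.
rewrite [X in _ * fine X]mDE.
rewrite mulrC subKr /Rintegral; congr fine.
apply: eq_measure_integral => A mA AD.
by rewrite /m /= /mfrestr /mrestr setIidl.
Qed.

(** * The density of [-dF] and the derivative of [F] *)

(** By [absolutely_continuous_null], [nu] restricted to [a, b[ is dominated by the Lebesgue measure;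
    [g] is its Radon-Nikodym density, made real-valued. *)
Lemma decrement_density (R : realType) (F : R -> R) (a b : R)
    (nu : {measure set (measurableTypeR R) -> \bar R}) : a <= b ->
  (forall x y, a <= x -> x <= y -> y <= b -> nu `[x, y[%classic = (F x - F y)%:E) ->
  absolutely_continuous_on a b F ->
  exists g : R -> R,
    [/\ (@lebesgue_measure R).-integrable setT (EFin \o g),
        forall x y, a <= x -> x <= y -> y <= b ->
          F x - F y = \int[@lebesgue_measure R]_(u in `[x, y]) g u &
        forall h : R -> R, (forall x, a <= x < b -> 0 <= h x) ->
          measurable_fun `[a, b[ h ->
          \int[nu]_(u in `[a, b[) h u =
          \int[@lebesgue_measure R]_(u in `[a, b[) (h u * g u)].
Proof.
move=> ab nuE acF.
pose D : set (measurableTypeR R) := `[a, b[%classic.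
have mD : measurable D by exact: measurable_itv.
have nuD : (nu D < +oo)%E by rewrite nuE// ltry.
pose m : {finite_measure set (measurableTypeR R) -> \bar R} := mfrestr mD nuD.
have mE A : measurable A -> A `<=` D -> m A = nu A.
  by move=> mA AD; rewrite /m /= /mfrestr /mrestr setIidl.
have m_leb : m `<< (@lebesgue_measure R).
  apply/null_content_dominatesP => A mA A0.
  exact: (absolutely_continuous_null _ F a b nu ab nuE acF A mA A0).
pose G := Radon_Nikodym_SigmaFinite.f m (@lebesgue_measure R).
have Gfin := Radon_Nikodym_SigmaFinite.f_fin_num m_leb.
have intG := Radon_Nikodym_SigmaFinite.f_integrable m_leb.
have GE := Radon_Nikodym_SigmaFinite.f_integral m_leb.
pose g := fine \o G.
have gG : EFin \o g = G by apply/funext => x; rewrite /g /= fineK.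
have intg : (@lebesgue_measure R).-integrable setT (EFin \o g) by rewrite gG.
exists g; split => //.
- move=> x y ax xy yb.
  rewrite -Rintegral_itv_bndo_bndc; last by apply: integrableS intg.
  rewrite /Rintegral.
  under eq_integral do rewrite -[(g _)%:E]/((EFin \o g) _) gG.
  rewrite -GE; last exact: measurable_itv.
  rewrite mE; [by rewrite nuE|exact: measurable_itv|].
  by apply: subset_itv; rewrite bnd_simp.
- move=> h h0 mh.
  (* The change of variables is applied to a function nonnegative on the whole line, hence the
     extension by zero. *)
  pose k := (EFin \o h) \_ D.
  have k0 x : (0 <= k x)%E.
    by rewrite /k patchE; case: ifPn => // /[!inE]; rewrite /D/= in_itv/= => /h0; rewrite lee_fin.
  have kE x : x \in D -> k x = (h x)%:E by move=> xD; rewrite /k patchE xD.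
  have mk : measurable_fun D k.
    apply/measurable_restrict => //; rewrite setIid; exact/measurable_EFinP.
  rewrite /Rintegral; congr fine.
  rewrite (@eq_measure_integral _ _ _ _ m)//; last first.
    by move=> A mA AD; exact/esym/mE.
  transitivity (\int[m]_(x in D) k x)%E.
    by apply: eq_integral => x /kE.
  rewrite -(Radon_Nikodym_SigmaFinite.change_of_variables m_leb k0 mD mk).
  by apply: eq_integral => x /kE ->; rewrite EFinM (fineK (Gfin x)).
Qed.

(** Lebesgue's differentiation theorem for the indefinite integral of [g]; around an interior point,
    [F] equals [F a] minus that integral on a whole neighbourhood. *)
Lemma derive1_density (R : realType) (F g : R -> R) (a b : R) :
  (@lebesgue_measure R).-integrable setT (EFin \o g) ->
  (forall x, a <= x -> x <= b ->
     F a - F x = \int[@lebesgue_measure R]_(u in `[a, x]) g u) ->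
  {ae @lebesgue_measure R, forall x, a < x < b -> derive1 F x = - g x}.
Proof.
move=> intg FE.
have ig y : (@lebesgue_measure R).-integrable `[a, y] (EFin \o g).
  by apply: integrableS intg.
have locg : locally_integrable setT g.
  by apply: open_integrable_locally => //; exact: openT.
have := FTC1 ig locg; apply: filterS.
  exact: (ae_filter_ringOfSetsType (@lebesgue_measure R)).
move=> x H /andP[ax xb].
have [|dG GE] := H.
  by rewrite /= lte_fin.
rewrite -GE !derive1E.
have nF : \forall y \near x, F y = F a - \int[@lebesgue_measure R]_(u in `[a, y]) g u.
  near=> y; rewrite -FE ?subKr//.
    by apply/ltW; near: y; exact: lt_nbhsr.
  by apply/ltW; near: y; exact: lt_nbhsl.
rewrite (near_eq_derive _ nF).
by rewrite deriveB// derive_cst sub0r.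
Unshelve. all: by end_near. Qed.

Lemma Rintegral_derive1_density (R : realType) (F g : R -> R) (a b : R) :
  0 < a -> (@lebesgue_measure R).-integrable setT (EFin \o g) ->
  (forall x, a <= x -> x <= b ->
     F a - F x = \int[@lebesgue_measure R]_(u in `[a, x]) g u) ->
  - (\int[@lebesgue_measure R]_(u in `[a, b]) (derive1 F u / u)) =
  \int[@lebesgue_measure R]_(u in `[a, b[) (u^-1 * g u).
Proof.
move=> a0 intg FE; have [N [mN N0 subN]] := derive1_density _ _ _ _ _ intg FE.
have igV : (@lebesgue_measure R).-integrable `[a, b] (EFin \o (fun u => u^-1 * g u)).
  apply: (@le_integrable _ _ _ (@lebesgue_measure R) `[a, b]%classic _ _
    (fun t => (a^-1 * g t)%:E)) => [//||t|].
  - apply/measurable_EFinP/measurable_funM; first exact: measurable_fun_inv_itv.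
    apply: measurable_funTS; apply/measurable_EFinP; exact: (measurable_int (@lebesgue_measure R)).
  - rewrite /= in_itv/= => /andP[at_ _]; have t0 := lt_le_trans a0 at_.
    rewrite lee_fin !normrM ler_wpM2r// !ger0_norm ?invr_ge0 ?(ltW t0) ?(ltW a0)//.
    by rewrite lef_pV2 ?posrE.
  - by apply: (integrableZl _ _ (integrableS _ _ _ intg)).
rewrite Rintegral_itv_bndo_bndc; last first.
  by apply: integrableS igV => //; apply: subset_itvl; rewrite bnd_simp.
rewrite -[RHS]mul1r -[1]opprK mulNr; congr (- _).
rewrite -RintegralZl//; congr fine.
(* The endpoints join the exceptional set because the derivative is identified only at interior
   points. *)
pose N' : set (measurableTypeR R) := N `|` ([set a] `|` [set b]).
have m1 (c : R) : measurable ([set c] : set (measurableTypeR R)) by exact: measurable_set1.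
have mN' : measurable N'.
  by apply: measurableU => //; exact: measurableU.
apply: (@eq_integral_off_null_set _ _ _ _ N') => //.
  apply/eqP; rewrite -measure_le0.
  rewrite (le_trans (measureU2 _ _ _))//; first exact: measurableU.
  rewrite [X in (X + _)%E]N0 add0e (le_trans (measureU2 _ _ _))//.
  by rewrite [X in (X + _)%E]lebesgue_measure_set1 [X in (_ + X)%E]lebesgue_measure_set1 add0e.
move=> x; rewrite /= in_itv/= => /andP[ax xb] N'x.
have axb : a < x < b.
  rewrite !lt_neqAle ax xb !andbT; apply/andP; split; apply/eqP => xE; apply: N'x.
    by right; left.
  by right; right.
have -> : derive1 F x = - g x.
  apply: contrapT => dF; apply: N'x; left; apply: subN => /=.
  by move=> /(_ axb).
by rewrite mulN1r mulNr mulrC.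
Qed.

(** For a lower bound with jumps, the almost-everywhere derivative misses their contribution: a step
    function has derivative 0 almost everywhere but a nonzero estimate. The simpler form is
    therefore an integral against [-dF] in general, and an integral of the derivative under absolute
    continuity. The last clause is the reduction to [lower_bound S f v 1 = 0]. *)
Theorem lemma4p1 (R : realType) (V : Type) (S : monotone_scheme R V)
    (f : V -> R) (f_ge0 : forall v : V, 0 <= f v)
    (fL : R -> V -> R) (fL_Lstar : is_Lstar S f fL) :
  [/\ forall (v : V) (rho : R), 0 < rho <= 1 ->
        fL rho v = lower_bound S f v rho / rho
          - \int[@lebesgue_measure R]_(u in `[rho, 1])
              (lower_bound S f v u / u ^+ 2),
      forall v : V, lower_bound S f v 1 = 0 ->
        exists2 nu : {measure set (measurableTypeR R) -> \bar R},
          is_decrement_measure (lower_bound S f v) nu &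
          forall rho : R, 0 < rho <= 1 ->
            fL rho v = \int[nu]_(u in `[rho, 1[) u^-1,
      forall v : V, lower_bound S f v 1 = 0 ->
        forall rho : R, 0 < rho <= 1 ->
          absolutely_continuous_on rho 1 (lower_bound S f v) ->
          fL rho v = - \int[@lebesgue_measure R]_(u in `[rho, 1])
                         (derive1 (lower_bound S f v) u / u)
    & let g := fun z : V => f z - lower_bound S f z 1 in
      [/\ forall z : V, 0 <= g z,
          forall v : V, lower_bound S g v 1 = 0
        & forall gL, is_Lstar S g gL ->
            is_Lstar S f (fun (u : R) (v : V) => gL u v + lower_bound S f v 1)]].
Proof.
have fLE v rho := Lstar_eq R V S f fL v rho fL_Lstar.
have nuE v : lower_bound S f v 1 = 0 ->
    exists2 nu : {measure set (measurableTypeR R) -> \bar R},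
      is_decrement_measure (lower_bound S f v) nu &
      forall rho : R, 0 < rho <= 1 -> fL rho v = \int[nu]_(u in `[rho, 1[) u^-1.
  move=> F1; have [nu nuF] := exists_decrement_measure _ (lower_bound S f v) (f v)
    (lower_bound_nincr S f f_ge0 v) (lower_bound_le S f f_ge0 v)
    (lower_bound_left_continuous S f f_ge0 v).
  exists nu => // rho rho01.
  by rewrite fLE// (Rintegral_decrement_inv _ _ _ _ nuF).
split => //.
- move=> v /nuE[nu nuF fLnu] rho /[dup] rho01 /andP[rho0 rho1] acF.
  have nuE' x y : rho <= x -> x <= y -> y <= 1 ->
      nu `[x, y[%classic = (lower_bound S f v x - lower_bound S f v y)%:E.
    by move=> rx xy y1; rewrite nuF// (lt_le_trans rho0).
  have [g [intg FE hE]] := decrement_density _ _ _ _ _ rho1 nuE' acF.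
  rewrite fLnu// (Rintegral_derive1_density _ _ g)//; last first.
    by move=> x rx x1; rewrite FE.
  apply: hE => [x /andP[rx _]|]; first by rewrite invr_ge0 (le_trans (ltW rho0)).
  apply: (@measurable_funS _ _ _ _ `[rho, 1]%classic) => //.
    by apply: subset_itvl; rewrite bnd_simp.
  exact: measurable_fun_inv_itv.
- move=> g; split.
  + exact: lower_bound_sub1_ge0.
  + by move=> v; rewrite lower_bound_sub1// ?subrr// ltr01 lexx.
  + exact: Lstar_sub1.
Qed.
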